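(* Let $n\ge 2$ be an integer. For any positive integer $C_0$, there exist two matrices $M_0,N_0\in\mathrm{Mat}_n(\mathbb{Z})$ which are similar over $\mathbb{Z}_p$ for every prime $p$, such that $C_{\mathbb{Q}}(M_0,N_0)\geq C_0$.
   Context: For a commutative ring $R$, two matrices $M,N\in\mathrm{Mat}_n(R)$ are called similar over $R$ if there exists $U\in\mathrm{GL}_n(R)$ with $UM=NU$. For a number field $K$, $\mathcal{O}_K$ denotes its ring of integers. For $M,N\in\mathrm{Mat}_n(\mathcal{O}_K)$ that are similar over the completion $\mathcal{O}_{K_{\mathfrak{p}}}$ for every finite place $\mathfrak{p}$ of $K$, define \[C_K(M,N):=\min\{[L:K] : L/K \text{ is a finite extension such that } M,N \text{ are similar over } \mathcal{O}_L\}\] (such an $L$ exists by a theorem of Guralnick). *)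

(* Defs.v *)
From HB Require Import structures.
From mathcomp Require Import all_boot all_order all_algebra all_field.
From mathcomp Require Import boolp.

Set Implicit Arguments.
Unset Strict Implicit.
Unset Printing Implicit Defensive.

Import GRing.Theory.
Local Open Scope ring_scope.

Definition similar_over (R : comUnitRingType) (n : nat) (M N : 'M[R]_n) : Prop :=
  exists2 U : 'M[R]_n, U \in unitmx & U *m M = N *m U.

(* Units and inverses of an arbitrary commutative ring, by classical choice;
   as everywhere in MathComp, the inverse of a non-unit is itself. *)
Section ClassicalUnits.
Variable R : comNzRingType.

Definition cunit : {pred R} := fun x => `[< exists y : R, y * x = 1 >].

Definition cinv (x : R) : R :=
  if pselect (exists y : R, y * x = 1) is left ex then sval (cid ex) else x.

Lemma cmulVx : {in cunit, left_inverse 1 cinv *%R}.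
Proof.
by move=> x /asboolP ex; rewrite /cinv; case: pselect => // e; case: cid.
Qed.

Lemma cunitPl x y : y * x = 1 -> cunit x.
Proof. by move=> yx; apply/asboolP; exists y. Qed.

Lemma cinv_out : {in [predC cunit], cinv =1 id}.
Proof.
move=> x; rewrite inE => /asboolP ex.
by rewrite /cinv; case: pselect.
Qed.

End ClassicalUnits.

Definition reduce (p k : nat) (a : 'Z_(p ^ k.+2)) : 'Z_(p ^ k.+1) := inZp a.

(* Z_p as the inverse limit of the rings Z/p^(k+1), k : nat.  The exponent
   starts at 1 because 'Z_1 is not the zero ring in MathComp.  Only p > 1 is
   meaningful; for p <= 1 the type below is still a ring, but a junk one. *)
Record padic_int (p : nat) := PadicInt {
  residue : forall k : nat, 'Z_(p ^ k.+1);
  residue_coherent : forall k : nat, reduce (residue k.+1) = residue k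
}.

Section PadicInt.
Variable p : nat.
Local Notation Zp := (padic_int p).
Implicit Types x y z : Zp.

Lemma padic_eq x y : (forall k, residue x k = residue y k) -> x = y.
Proof.
case: x y => [x hx] [y hy] /= exy.
have {}exy : x = y by apply: functional_extensionality_dep.
case: y / exy hy => hy; congr PadicInt.
by apply: functional_extensionality_dep => k; apply: eq_irrelevance.
Qed.

HB.instance Definition _ := gen_eqMixin Zp.
HB.instance Definition _ := gen_choiceMixin Zp.

Lemma padic_modulus_dvd k :
  ((Zp_trunc (p ^ k.+1)).+2 %| (Zp_trunc (p ^ k.+2)).+2)%N.
Proof.
case: p => [|[|q]]; rewrite ?exp0n ?exp1n //.
by rewrite !Zp_cast ?dvdn_exp2l // -{1}(expn0 q.+2) ltn_exp2l.
Qed.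

Lemma padic_add_coh x y k :
  reduce (residue x k.+1 + residue y k.+1) = residue x k + residue y k.
Proof.
rewrite -!(residue_coherent _ k); apply: val_inj => /=.
by rewrite modn_dvdm ?padic_modulus_dvd // modnDm.
Qed.

Lemma padic_mul_coh x y k :
  reduce (residue x k.+1 * residue y k.+1) = residue x k * residue y k.
Proof.
rewrite -!(residue_coherent _ k); apply: val_inj => /=.
by rewrite modn_dvdm ?padic_modulus_dvd // modnMm.
Qed.

Lemma padic_opp_coh x k : reduce (- residue x k.+1) = - residue x k.
Proof.
apply/eqP; rewrite -addr_eq0 -(residue_coherent _ k); apply/eqP.
apply: val_inj => /=; rewrite modn_dvdm ?padic_modulus_dvd // modnDm.
rewrite subnK; last exact/ltnW/ltn_ord.
by apply/eqP; apply: padic_modulus_dvd.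
Qed.

Lemma padic_zero_coh k : reduce (0 : 'Z_(p ^ k.+2)) = 0.
Proof. by apply: val_inj; rewrite /= mod0n. Qed.

Lemma padic_one_coh k : reduce (1 : 'Z_(p ^ k.+2)) = 1.
Proof. by apply: val_inj. Qed.

Definition padic_zero : Zp := PadicInt padic_zero_coh.
Definition padic_one : Zp := PadicInt padic_one_coh.
Definition padic_opp x : Zp := PadicInt (padic_opp_coh x).
Definition padic_add x y : Zp := PadicInt (padic_add_coh x y).
Definition padic_mul x y : Zp := PadicInt (padic_mul_coh x y).

Lemma padic_addA : associative padic_add.
Proof. by move=> x y z; apply: padic_eq => k /=; rewrite addrA. Qed.
Lemma padic_addC : commutative padic_add.
Proof. by move=> x y; apply: padic_eq => k /=; rewrite addrC. Qed.
Lemma padic_add0 : left_id padic_zero padic_add.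
Proof. by move=> x; apply: padic_eq => k /=; rewrite add0r. Qed.
Lemma padic_addN : left_inverse padic_zero padic_opp padic_add.
Proof. by move=> x; apply: padic_eq => k /=; rewrite addNr. Qed.

HB.instance Definition _ :=
  GRing.isZmodule.Build Zp padic_addA padic_addC padic_add0 padic_addN.

Lemma padic_mulA : associative padic_mul.
Proof. by move=> x y z; apply: padic_eq => k /=; rewrite mulrA. Qed.
Lemma padic_mulC : commutative padic_mul.
Proof. by move=> x y; apply: padic_eq => k /=; rewrite mulrC. Qed.
Lemma padic_mul1 : left_id padic_one padic_mul.
Proof. by move=> x; apply: padic_eq => k /=; rewrite mul1r. Qed.
Lemma padic_mulD : left_distributive padic_mul padic_add.
Proof. by move=> x y z; apply: padic_eq => k /=; rewrite mulrDl. Qed.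
Lemma padic_one_neq0 : padic_one != 0.
Proof.
apply/eqP => /(congr1 (fun x : Zp => residue x 0)) /= /eqP.
by rewrite oner_eq0.
Qed.

HB.instance Definition _ := GRing.Zmodule_isComNzRing.Build Zp
  padic_mulA padic_mulC padic_mul1 padic_mulD padic_one_neq0.
HB.instance Definition _ := GRing.ComNzRing_hasMulInverse.Build Zp
  (@cmulVx Zp) (@cunitPl Zp) (@cinv_out Zp).

End PadicInt.

(* The elements of a field that are integral over Z. *)
Definition integralZ (K : fieldType) : {pred K} :=
  fun x => `[< integralOver (intr : int -> K) x >].

Lemma integralZ_subring (K : fieldType) : subring_closed (@integralZ K).
Proof.
split=> [|x y /asboolP ix /asboolP iy|x y /asboolP ix /asboolP iy];
  apply/asboolP.
- exact: integral1.
- exact: integral_sub.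
- exact: integral_mul.
Qed.

HB.instance Definition _ (K : fieldType) :=
  GRing.isSubringClosed.Build K (@integralZ K) (@integralZ_subring K).

(* O_K, for a number field K. *)
Record ringOfIntegers (K : fieldType) := RingOfIntegers {
  alg_val :> K;
  alg_valP : alg_val \in @integralZ K
}.

HB.instance Definition _ (K : fieldType) := [isSub for @alg_val K].
HB.instance Definition _ (K : fieldType) :=
  [Choice of ringOfIntegers K by <:].
HB.instance Definition _ (K : fieldType) :=
  [SubChoice_isSubComNzRing of ringOfIntegers K by <:].
HB.instance Definition _ (K : fieldType) :=
  GRing.ComNzRing_hasMulInverse.Build (ringOfIntegers K)
    (@cmulVx (ringOfIntegers K)) (@cunitPl (ringOfIntegers K))
    (@cinv_out (ringOfIntegers K)).

Lemma integralZ_in_alg (K : fieldType) (L : fieldExtType K)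
  (x : ringOfIntegers K) : in_alg L (alg_val x) \in @integralZ L.
Proof.
have /asboolP ix := alg_valP x; apply/asboolP.
have [p mp rp] := integral_rmorph (in_alg L) ix.
exists p => //; rewrite -(@eq_map_poly _ _ (in_alg L \o intr)) //.
by move=> z /=; rewrite -[RHS](rmorph_int (in_alg L)).
Qed.

(* The inclusion of O_K in O_L for a finite extension L/K. *)
Definition integers_incl (K : fieldType) (L : fieldExtType K)
  (x : ringOfIntegers K) : ringOfIntegers L :=
  RingOfIntegers (integralZ_in_alg L x).

(* d is the degree of a finite extension L/K over whose ring of integers M and
   N become similar; a fieldExtType is a finite extension by definition. *)
Definition similar_in_degree (K : fieldExtType rat) (n : nat)
    (M N : 'M[ringOfIntegers K]_n) (d : nat) : Prop :=
  exists L : fieldExtType K,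
    \dim {:L} = d /\
    similar_over (map_mx (@integers_incl K L) M) (map_mx (@integers_incl K L) N).

(* C_K(M,N), the least such degree.  If there is none (which does not happen
   when M and N are similar over every completion) the value is 0, which is
   not the degree of any extension. *)
Definition C_K (K : fieldExtType rat) (n : nat)
    (M N : 'M[ringOfIntegers K]_n) : nat :=
  if pselect (exists d, `[< similar_in_degree M N d >]) is left ex
  then ex_minn ex else 0%N.

(* C_Q(M,N) for integer matrices: Q is rat as an extension of itself, and the
   entries are mapped by the canonical morphism from int to O_Q. *)
Definition C_Q (n : nat) (M N : 'M[int]_n) : nat :=
  C_K (K := rat^o : fieldExtType rat) (map_mx intr M) (map_mx intr N).

(* Main.v *)
Require Import Defs.
From HB Require Import structures.
From mathcomp Require Import all_boot all_order all_algebra.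
From mathcomp Require Import all_field.
From mathcomp Require Import boolp zify ring.

(** Let T(a) be the block sum of ((0, a), (0, m)) and an identity matrix, where m
    is neither 0 nor 1.  Over any ring where m and m - 1 are regular, T(1) and
    T(a) are similar if and only if a is congruent modulo m to a unit of the
    ring ([similar_twist], [unit_of_similar_twist]).  Take a = -2 and
    m = 2 ^ (C0 + 1) + 1, which is prime to a.

    Over the p-adic integers, either a (for p odd) or a - m (for p = 2) is a
    unit, so that T(1) and T(a) are similar.

    If T(1) and T(a) are similar over the ring of integers of L, there is a unit
    u = a - m w with w integral.  Its norm from Q(w) to Q is 1 or -1 and is
    congruent to a ^ r modulo m, where r = [Q(w) : Q] is at most [L : Q]
    ([unit_sub_mul_expr]).  Now (-2) ^ r is neither 1 nor -1 modulo m when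
    0 < r < C0, by size, so [L : Q] is at least C0.

    Finally, the minimum that defines C_Q has to be taken over a nonempty set.
    As 2 ^ (C0 + 1) = -1 modulo m, a root y of a suitable monic trinomial of
    degree C0 + 1 makes m y - 2 a unit ([exists_unit_ext]). *)

Import GRing.Theory Num.Theory.
Local Open Scope ring_scope.

Set Implicit Arguments.
Unset Strict Implicit.
Unset Printing Implicit Defensive.

(** * Similarity of the matrices T(1) and T(a) *)

(** The matrix T(a): the block diagonal matrix with blocks ((0, a), (0, m))
    and the identity of size k.  Its eigenvalues are 0, m and, when k > 0, 1. *)
Definition twist (R : pzRingType) (k : nat) (m a : R) : 'M[R]_(1 + 1 + k) :=
  block_mx (block_mx 0 a%:M 0 m%:M) 0 0 1%:M.

Lemma map_twist (R S : pzRingType) (f : {rmorphism R -> S}) k (m a : R) :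
  map_mx f (twist k m a) = twist k (f m) (f a).
Proof. by rewrite /twist !map_block_mx !map_mx0 !map_scalar_mx rmorph1. Qed.

(** The conjugating matrix has blocks ((a - m q, q), (0, 1)) and the
    identity. *)
Lemma similar_twist (R : comUnitRingType) k (m a q : R) :
  a - m * q \is a GRing.unit ->
  similar_over (twist k m 1) (twist k m a).
Proof.
move=> u; exists (block_mx (block_mx (a - m * q)%:M q%:M 0 1%:M) 0 0 1%:M).
  by rewrite unitmxE det_lblock det_ublock !det_scalar1 det1 !mulr1.
rewrite /twist !mulmx_block ?(mulmx0, mul0mx, mulmx1, mul1mx, addr0, add0r).
by rewrite mul_scalar_mx scale_scalar_mx -raddfD /= [q * m]mulrC subrK.
Qed.

(** Since m and m - 1 are regular, the eigenvalue 1 of the identity block is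
    separated from the eigenvalues 0 and m, so that an intertwining matrix is
    block triangular and its upper left block is itself invertible. *)
Lemma unit_of_similar_twist (R : comUnitRingType) k (m a : R) :
  GRing.lreg m -> GRing.lreg (m - 1) ->
  similar_over (twist k m 1) (twist k m a) ->
  exists q, a - m * q \is a GRing.unit.
Proof.
move=> mreg m1reg [U Uu].
rewrite -[U]submxK; set U1 := ulsubmx U; set U2 := ursubmx U.
rewrite -(submxK U) -/U1 -/U2 in Uu.
rewrite -[U1]submxK /twist; set P := ulsubmx U1; set Q := ursubmx U1.
set V := dlsubmx U1; set S := drsubmx U1.
rewrite !mulmx_block ?(mulmx0, mul0mx, mulmx1, mul1mx, addr0, add0r).
case/eq_block_mx => eq1 eq2 _ _.
(* (N - 1) U2 = 0, where N is the 2 x 2 block and det (N - 1) = 1 - m. *)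
have U20 : U2 = 0.
  move: eq2; rewrite -[U2]vsubmxK mul_block_col !mul0mx !add0r !mul_scalar_mx.
  case/eq_col_mx => eu ed.
  have d0 : dsubmx U2 = 0.
    apply/matrixP => i j; move/matrixP/(_ i j): ed; rewrite !mxE => ed.
    by apply: m1reg; rewrite mulr0 mulrBl mul1r -ed subrr.
  by rewrite eu d0 scaler0 col_mx0.
move: eq1; rewrite !mul_scalar_mx !mul_mx_scalar.
case/eq_block_mx => _ e01 e10 _.
have V0 : V = 0.
  apply/matrixP => i j; move/matrixP/(_ i j): e10; rewrite !mxE => e10.
  by apply: mreg; rewrite mulr0 -e10.
move: Uu; rewrite U20 unitmxE det_lblock unitrM => /andP[].
rewrite -[U1]submxK -/P -/Q -/V -/S V0 det_ublock unitrM => /andP[].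
have {}e01 : P 0 0 + m * Q 0 0 = a * S 0 0.
  by move/matrixP/(_ 0 0): e01; rewrite !mxE.
rewrite !det_mx11 => Pu Su _.
exists (Q 0 0 / S 0 0); rewrite -(unitrMl _ Su).
by rewrite mulrBl mulrA divrK // -e01 addrK.
Qed.

(** * Units of the p-adic integers *)

Lemma residue_natr p (n : nat) k : residue (n%:R : padic_int p) k = n%:R.
Proof. by elim: n => [|n IHn] //; rewrite !mulrS -IHn. Qed.

Lemma reduceM p k (x y : 'Z_(p ^ k.+2)) :
  reduce (x * y) = reduce x * reduce y.
Proof.
by apply: val_inj; rewrite /= modn_dvdm ?padic_modulus_dvd // modnMm.
Qed.

Lemma padic_natr_unit p n :
  prime p -> coprime p n -> (n%:R : padic_int p) \is a GRing.unit.
Proof.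
move=> p_pr co_pn.
have un k : (n%:R : 'Z_(p ^ k.+1)) \is a GRing.unit.
  by rewrite unitZpE ?coprimeXl // (ltn_exp2l 0) ?prime_gt1.
have coh k : reduce ((n%:R : 'Z_(p ^ k.+2))^-1) = n%:R^-1.
  have En : (n%:R : 'Z_(p ^ k.+1)) = reduce n%:R.
    by rewrite -!(residue_natr p) residue_coherent.
  have : reduce ((n%:R : 'Z_(p ^ k.+2))^-1 * n%:R) = 1.
    by rewrite (mulVr (un k.+1)); apply: padic_one_coh.
  rewrite reduceM -En => E; apply: (mulIr (un k)); rewrite (mulVr (un k)).
  exact: E.
apply/unitrP; exists (PadicInt coh).
have vn : PadicInt coh * n%:R = 1.
  apply: padic_eq => k.
  transitivity ((n%:R : 'Z_(p ^ k.+1))^-1 * n%:R); last exact: mulVr (un k).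
  change (n%:R^-1 * residue (n%:R : padic_int p) k = n%:R^-1 * n%:R).
  by rewrite residue_natr.
by rewrite [n%:R * _]mulrC.
Qed.

(** * Units congruent to an integer in rings of integers *)

(** The minimal polynomial over Q of an algebraic integer has integer
    coefficients (Gauss), hence divides in Z[X] every integer polynomial that
    vanishes at x. *)
Lemma integral_minPolyZ (L : fieldExtType rat) (x : L) :
  integralOver (intr : int -> L) x ->
  exists2 g : {poly int}, g \is monic /\ (1 < size g <= (\dim {:L}).+1)%N
    & forall F : {poly int}, root (map_poly intr F) x -> exists h, F = g * h.
Proof.
case=> f f_mon fx0.
have /polyOver1P[q Eq] := minPolyOver 1%AS x.
have mapE (F : {poly int}) :
    map_poly (in_alg L) (map_poly intr F) = map_poly intr F.
  rewrite -map_poly_comp; apply: eq_map_poly => z /=.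
  by rewrite -[RHS](rmorph_int (in_alg L)).
have qdvd (F : {poly int}) : root (map_poly intr F) x -> q %| map_poly intr F.
  move=> Fx0; rewrite -(dvdp_map (in_alg L)) -Eq mapE.
  apply: minPoly_dvdp => //; rewrite -mapE; apply/polyOver1P.
  by exists (map_poly intr F).
have [p1 [a a0 Eq1] [r Er]] := dvdpP_rat_int (qdvd f fx0).
have lead_f : lead_coef p1 * lead_coef r = 1.
  by rewrite -lead_coefM -Er (monicP f_mon).
have lead_sq : lead_coef p1 * lead_coef p1 = 1.
  move: lead_f; set u := lead_coef p1; set v := lead_coef r => uv1.
  have /eqP : (`|u| * `|v|)%N = 1%N by rewrite -abszM uv1.
  by rewrite muln_eq1 => /andP[/eqP u1 _]; nia.
have lead0 : lead_coef p1 != 0.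
  by apply: contra_eq_neq lead_sq => ->; rewrite mul0r.
(* The leading coefficient of p1 is 1 or -1: scaling by it makes p1 monic. *)
exists (lead_coef p1 *: p1); first split.
- by apply/monicP; rewrite lead_coefZ.
- rewrite size_scale //.
  have ->: size p1 = size (minPoly 1%AS x).
    by rewrite Eq size_map_poly Eq1 size_scale // size_map_inj_poly //;
       exact: intr_inj.
  rewrite size_minPoly !ltnS; apply/andP; split=> //.
  have := dim_Fadjoin 1%AS x; rewrite dimv1 muln1 => <-.
  by rewrite dimvS ?subvf.
move=> F Fx0.
have : lead_coef p1 *: p1 %| F.
  rewrite (dvdpZl _ _ lead0) -dvdp_rat_int -(dvdpZl _ _ a0) -Eq1.
  exact: qdvd.
have g_mon : lead_coef p1 *: p1 \is monic by apply/monicP; rewrite lead_coefZ.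
by case/(Pdiv.IdomainMonic.dvdpP g_mon) => h ->; exists h; rewrite mulrC.
Qed.

(** The homogenization of p to degree N, evaluated at (a, m); it equals
    m ^ N * p(a / m) when p has degree at most N and m is nonzero. *)
Definition homog (m a : int) (N : nat) (p : {poly int}) : int :=
  \sum_(i < N.+1) p`_i * a ^+ i * m ^+ (N - i).

Lemma homogE (m a : int) N (p : {poly int}) :
  m != 0 -> (size p <= N.+1)%N ->
  (homog m a N p)%:~R = m%:~R ^+ N * (map_poly intr p).[a%:~R / m%:~R] :> rat.
Proof.
move=> m0 szp; rewrite (horner_coef_wide _ (leq_trans (size_poly _ _) szp)).
rewrite mulr_sumr rmorph_sum; apply: eq_bigr => -[i /= ltiN] _.
rewrite coef_map !rmorphM !rmorphXn /= expr_div_n.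
have mR0 : m%:~R != 0 :> rat by rewrite intr_eq0.
rewrite -{2}(subnK (_ : i <= N)%N) // exprD.
have := expf_neq0 i mR0; set u := (m%:~R ^+ i) => u0.
by field.
Qed.

Lemma homog_monic (m a : int) (p : {poly int}) N :
  p \is monic -> size p = N.+1 -> exists c, homog m a N p = a ^+ N + m * c.
Proof.
move=> /monicP; rewrite lead_coefE => + szp; rewrite szp /= => pN.
rewrite /homog big_ord_recr /= pN subnn mul1r mulr1.
exists (\sum_(i < N) p`_i * a ^+ i * m ^+ (N - i).-1).
rewrite addrC mulr_sumr; congr (_ + _); apply: eq_bigr => -[i /= ltiN] _.
by rewrite mulrCA -exprS prednK // subn_gt0.
Qed.

(** The witness is the reciprocal polynomial of a monic polynomial that
    vanishes at v. *)
Lemma inverse_integral_poly (L : fieldType) (t v : L) :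
  integralOver (intr : int -> L) v -> t * v = 1 ->
  exists2 F : {poly int}, F`_0 = 1 & root (map_poly intr F) t.
Proof.
case=> f f_mon fv0 tv1.
have sz0 : (0 < size f)%N by rewrite size_poly_gt0 monic_neq0.
exists (\poly_(i < size f) f`_((size f).-1 - i)).
  by rewrite coef_poly sz0 subn0 -lead_coefE (monicP f_mon).
have wide (p : {poly int}) n (x : L) : (size p <= n)%N ->
    (map_poly intr p).[x] = \sum_(i < n) (p`_i)%:~R * x ^+ i.
  move=> szp; have szp' : (size (map_poly (intr : int -> L) p) <= n)%N.
    exact: leq_trans (size_poly _ _) szp.
  by rewrite (horner_coef_wide _ szp'); apply: eq_bigr => i _; rewrite coef_map.
rewrite /root (wide _ _ _ (size_poly _ _)) (reindex_inj rev_ord_inj) /=.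
move: fv0; rewrite /root (wide _ _ _ (leqnn _)) => /eqP.
move/(congr1 ( *%R (t ^+ (size f).-1))); rewrite mulr0 mulr_sumr => E.
apply/eqP; rewrite -[RHS]E; apply: eq_bigr => -[i /= ltif] _.
rewrite coef_poly ltn_subrL sz0 /=.
have revK N : (i < N -> N.-1 - (N - i.+1) = i)%N by lia.
have predE N : (i < N -> N.-1 = N - i.+1 + i)%N by lia.
rewrite (revK _ ltif) mulrCA; congr (_ * _).
by rewrite (predE _ ltif) exprD -mulrA -exprMn tv1 expr1n mulr1.
Qed.

(** A unit congruent to a modulo m in the ring of integers of L forces a power
    of a, of positive exponent at most [L : Q], to be 1 or -1 modulo m.  The
    exponent r is the degree of the minimal polynomial g of w, and m ^ r * g(a / m), which is
    congruent to a ^ r modulo m, is the norm of a - m w from Q(w) to Q.  That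
    it is a unit follows from the factorization F(a - m X) = g * h with F(0) = 1,
    evaluated at a / m. *)
Lemma unit_sub_mul_expr (L : fieldExtType rat) (w v : L) (a m : int) :
  m != 0 -> coprimez a m ->
  integralOver (intr : int -> L) w -> integralOver (intr : int -> L) v ->
  (a%:~R - m%:~R * w) * v = 1 ->
  exists2 r : nat, (0 < r <= \dim {:L})%N &
    (m %| a ^+ r - 1)%Z || (m %| a ^+ r + 1)%Z.
Proof.
move=> m0 co_am w_int v_int tv1.
have [F F0 Ft0] := inverse_integral_poly v_int tv1.
have [g [g_mon szg] gdvd] := integral_minPolyZ w_int.
have compE (K : comNzRingType) (x : K) :
    (map_poly intr (F \Po (a%:P - m *: 'X))).[x]
      = (map_poly intr F).[a%:~R - m%:~R * x].
  rewrite map_comp_poly horner_comp rmorphB /= map_polyC.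
  by rewrite map_polyZ map_polyX !hornerE.
have Gw0 : root (map_poly intr (F \Po (a%:P - m *: 'X))) w.
  by rewrite /root compE.
have [h Egh] := gdvd _ Gw0.
pose r := (size g).-1; pose s := size h.
have Er : size g = r.+1 by rewrite /r prednK //; case/andP: szg; case: size.
have prod_hom : homog m a r g * homog m a s h = m ^+ (r + s).
  apply: (@intr_inj rat); rewrite rmorphM rmorphXn /=.
  rewrite !homogE ?Er // mulrACA -exprD -hornerM.
  have <- : map_poly intr (F \Po (a%:P - m *: 'X))
      = map_poly intr g * map_poly intr h :> {poly rat} by rewrite Egh rmorphM.
  rewrite compE mulrCA divff ?intr_eq0 // mulr1 subrr.
  by rewrite horner_coef0 coef_map F0 mulr1.
have [c Ec] := homog_monic m a g_mon Er.
(* The value of g divides a power of m, and it is prime to m as it is congruent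
   to a ^ r. *)
have co_hm : coprimez (homog m a r g) m.
  rewrite coprimez_sym Ec addrC mulrC /coprimez gcdzMDl -/(coprimez _ _).
  by rewrite coprimez_sym coprimezXl.
have unit_hom : (`|homog m a r g| == 1)%N.
  rewrite -dvdn1.
  have : (`|homog m a r g| %| 1 * `|m| ^ (r + s))%N.
    by rewrite mul1n -abszX -prod_hom abszM dvdn_mulr.
  by rewrite Gauss_dvdl // coprimeXr.
exists r; first by rewrite Er in szg.
have [E1|E1] : homog m a r g = 1 \/ homog m a r g = -1 by lia.
  apply/orP; left; have -> : a ^+ r - 1 = m * - c by rewrite -E1 Ec; ring.
  exact: dvdz_mulr.
apply/orP; right; have -> : a ^+ r + 1 = m * - c.
  by rewrite -[1]opprK -E1 Ec; ring.
exact: dvdz_mulr.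
Qed.

(** * Construction of an extension with a prescribed unit *)

Lemma exists_root_ext (F : fieldType) (p : {poly F}) :
  (1 < size p)%N ->
  exists (L : fieldExtType F) (z : L), root (map_poly (in_alg L) p) z.
Proof.
move=> p_gt1.
have [q q_irr qp] : exists2 q : {poly F}, irreducible_poly q & q %| p.
  elim: {p}_.+1 {-2}p (ltnSn (size p)) p_gt1 => // k IHk p szp p_gt1.
  have [//|p_red] := EM (irreducible_poly p); first by exists p.
  have [q [q1 qp nqp]] : exists q : {poly F},
      [/\ size q != 1%N, q %| p & ~~ (q %= p)].
    apply: contrapT => nq; apply: p_red; split=> // q q1 qp.
    by apply/negP => /negP nqp; apply: nq; exists q.
  have p0 : p != 0 by rewrite -size_poly_gt0 ltnW.
  have q0 : q != 0 by apply: contraTneq qp => ->; rewrite dvd0p.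
  have szq : (size q < size p)%N.
    by rewrite ltn_neqAle dvdp_leq // dvdp_size_eqp // nqp.
  have [||r r_irr rq] := IHk q; first exact: leq_trans szq _.
    by rewrite ltn_neqAle eq_sym q1 size_poly_gt0.
  by exists r => //; apply: dvdp_trans rq qp.
have [L _ [z qz _]] := irredp_FAdjoin q_irr.
by exists L, z; have /dvdpP[s ->] := qp; rewrite rmorphM rootM qz orbT.
Qed.

(** If b ^ d is -1 modulo m, then -b is congruent modulo m to a unit in the ring
    of integers of some finite extension.  One adjoins a root y of
    X ^ d + A X ^ (d - 1) + B; then t = m y - b is a root of the monic polynomial
    (X + b) ^ d + m A (X + b) ^ (d - 1) + m ^ d B, and A and B are chosen so that
    its constant term is -1. *)
Lemma exists_unit_ext (K : fieldType) (m b : int) (d : nat) :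
  (1 < d)%N -> (m %| b ^+ d + 1)%Z ->
  exists (L : fieldExtType K) (y : ringOfIntegers L),
    m%:~R * y - b%:~R \is a GRing.unit.
Proof.
case: d => [|[|e]] // _ /dvdzP[c Ec].
have co_bm : coprimez (b ^+ e.+1) (m ^+ e.+1).
  apply: coprimezXl; apply: coprimezXr; apply/coprimezP.
  by exists (- b ^+ e.+1, c); rewrite /= -Ec mulNr -exprSr addKr.
(* A and B are the Bezout coefficients scaled by - (b ^ d + 1) / m. *)
have [u [v]] := Bezoutz (b ^+ e.+1) (m ^+ e.+1).
rewrite (eqP co_bm) => Euv.
have [A [B EAB]] : exists A B : int,
    b ^+ e.+2 + m * A * b ^+ e.+1 + m ^+ e.+2 * B = -1.
  exists (- (c * u)), (- (c * v)).
  rewrite -[b ^+ e.+2](addrK 1) Ec [m ^+ e.+2]exprS.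
  transitivity (c * m * (1 - (u * b ^+ e.+1 + v * m ^+ e.+1)) - 1); first by ring.
  by rewrite Euv subrr mulr0 add0r.
pose p : {poly int} := 'X^(e.+2) + (A *: 'X^(e.+1) + B%:P).
have sz_tl : (size (A *: 'X^(e.+1) + B%:P)%R < size ('X^(e.+2) : {poly int}))%N.
  rewrite size_polyXn ltnS (leq_trans (size_polyD _ _)) // geq_max.
  rewrite (leq_trans (size_scale_leq _ _)) ?size_polyXn //=.
  by rewrite (leq_trans (size_polyC_leq1 _)).
have p_mon : p \is monic.
  by apply/monicP; rewrite lead_coefDl // lead_coefXn.
have mapE (R : nzRingType) (x : R) :
    (map_poly intr p).[x] = x ^+ e.+2 + (A%:~R * x ^+ e.+1 + B%:~R).
  rewrite !rmorphD /= map_polyZ !map_polyXn map_polyC.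
  by rewrite !(hornerD, hornerZ, hornerXn, hornerC).
have szp : (1 < size (map_poly (intr : int -> K) p))%N.
  by rewrite size_map_poly_id0 ?(monicP p_mon) ?rmorph1 ?oner_neq0 //
             size_polyDl // size_polyXn.
have [L [z pz0]] := exists_root_ext szp.
have {}pz0 : root (map_poly intr p) z.
  move: pz0; rewrite -map_poly_comp (eq_map_poly (g := intr)) // => i /=.
  by rewrite -[RHS](rmorph_int (in_alg L)).
have z_int : z \in @integralZ L by apply/asboolP; exists p.
pose y := RingOfIntegers z_int.
have y0 : y ^+ e.+2 + (A%:~R * y ^+ e.+1 + B%:~R) = 0.
  apply: val_inj; rewrite !rmorphD rmorphXn rmorphM rmorphXn !rmorph_int rmorph0 /=.
  by rewrite -mapE; apply/eqP.
exists L, y; set t := _ - _.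
have tE n : exists s, (m%:~R * y) ^+ n - b%:~R ^+ n = t * s.
  by rewrite subrXX; eexists.
have [s1 E1] := tE e.+2; have [s2 E2] := tE e.+1.
(* With t = m y - b, multiplying the equation of y by m ^ d and subtracting the
   relation between A and B gives t * (s1 + m A s2) = 1. *)
apply/unitrPr; exists (s1 + m%:~R * A%:~R * s2).
have toL i j : b ^+ i + m * A * b ^+ j + m ^+ i * B = -1 ->
    b%:~R ^+ i + m%:~R * A%:~R * b%:~R ^+ j + m%:~R ^+ i * B%:~R
      = -1 :> ringOfIntegers L.
  move/(congr1 (intr : int -> ringOfIntegers L)).
  by rewrite !rmorphD !rmorphM !rmorphXn rmorphN rmorph1.
have EABL := toL _ _ EAB.
rewrite mulrDr mulrCA -E1 -E2 !exprMn -[RHS]opprK -EABL.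
have := congr1 ( *%R (m%:~R ^+ e.+2)) y0; rewrite mulr0 => E0.
rewrite -[LHS]subr0 -E0; rewrite !exprS; ring.
Qed.

(** * Rings of integers and similarity *)

Lemma intr_integers_lreg (L : fieldExtType rat) (n : int) :
  n != 0 -> GRing.lreg (n%:~R : ringOfIntegers L).
Proof.
move=> n0 x y /(congr1 val); rewrite !rmorphM rmorph_int /= => /mulfI E.
apply: val_inj; apply: E; rewrite -(rmorph_int (in_alg L)).
by rewrite fmorph_eq0 intr_eq0.
Qed.

Lemma alg_val_int (K : fieldType) (x : int) :
  alg_val (x%:~R : ringOfIntegers K) = x%:~R.
Proof. exact: (rmorph_int (val : {rmorphism ringOfIntegers K -> K})). Qed.

Lemma map_twist_incl (K : fieldType) (L : fieldExtType K) k (m a : int) :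
  map_mx (@integers_incl K L) (map_mx intr (twist k m a)) =
  twist k m%:~R a%:~R.
Proof.
rewrite -map_mx_comp -(map_twist (intr : {rmorphism int -> ringOfIntegers L})).
apply: eq_map_mx => x; apply: val_inj.
by rewrite /= !alg_val_int -[RHS](rmorph_int (in_alg L)).
Qed.

(** Obstruction: the degree of an extension over which the two matrices become
    similar is at least the exponent r > 0 of some power of a that is 1 or -1
    modulo m. *)
Lemma similar_in_degree_twist k (m a : int) d :
  m != 0 -> m != 1 -> coprimez a m ->
  similar_in_degree (K := rat^o : fieldExtType rat)
    (map_mx intr (twist k m 1)) (map_mx intr (twist k m a)) d ->
  exists2 r : nat, (0 < r <= d)%N &
    (m %| a ^+ r - 1)%Z || (m %| a ^+ r + 1)%Z.
Proof.
move=> m0 m1 co_am [L [<-]]; rewrite !map_twist_incl.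
case/unit_of_similar_twist => [||q /unitrPr[v /(congr1 val)]].
- exact: (@intr_integers_lreg L).
- have -> : m%:~R - 1 = (m - 1)%:~R :> ringOfIntegers L.
    by rewrite rmorphB rmorph1.
  by apply: (@intr_integers_lreg L); rewrite subr_eq0.
rewrite rmorphM rmorphB rmorphM /= !alg_val_int => Ev.
have /asboolP q_int := alg_valP q; have /asboolP v_int := alg_valP v.
exact: (@unit_sub_mul_expr L (val q) (val v)).
Qed.

(** * The pair T(1), T(-2) for m = 2 ^ (C0 + 1) + 1 *)

Lemma pow2E N : 2 ^+ N.+1 + 1 = (2 * 2 ^ N + 1)%N :> int.
Proof. by rewrite PoszD -expnS -[Posz (_ ^ _)]natz natrX. Qed.

(** The numbers (-2) ^ r - 1 and (-2) ^ r + 1 are nonzero and smaller in absolute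
    value than 2 ^ (N + 1) + 1, as 2 <= 2 ^ r < 2 ^ N. *)
Lemma dvdz_pow2 (N r : nat) :
  (0 < r < N)%N ->
  ~~ (((2 ^+ N.+1 + 1 : int) %| (-2) ^+ r - 1)%Z
      || ((2 ^+ N.+1 + 1 : int) %| (-2) ^+ r + 1)%Z).
Proof.
case/andP=> r0 rN.
have lt2 : (2 ^ r < 2 ^ N)%N by rewrite ltn_exp2l.
have ge2 : (2 <= 2 ^ r)%N by rewrite -{1}(expn1 2) leq_exp2l.
have abs2 : (`|(-2 : int) ^+ r| = 2 ^ r)%N by rewrite abszX.
rewrite negb_or; apply/andP; split; apply/negP;
  rewrite pow2E dvdzE => /dvdn_leq; lia.
Qed.

Theorem theorem9 (n : nat) (hn : (2 <= n)%N) (C0 : nat) (hC0 : (0 < C0)%N) :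
  exists M0 N0 : 'M[int]_n,
    (forall p : nat, prime p ->
       similar_over (map_mx (intr : int -> padic_int p) M0)
                    (map_mx (intr : int -> padic_int p) N0)) /\
    (C0 <= C_Q M0 N0)%N.
Proof.
case: n hn => [|[|k]] // _.
pose m : int := 2 ^+ C0.+1 + 1.
have mE : m = (2 * 2 ^ C0 + 1)%N by exact: pow2E.
exists (twist k m 1), (twist k m (-2)); split=> [p p_pr|].
  rewrite !(map_twist (intr : {rmorphism int -> padic_int p})) rmorph1.
  (* For p = 2 the integer -2 - m is odd; for p odd, -2 itself is a unit. *)
  have [->|p_neq2] := eqVneq p 2%N.
    apply: (@similar_twist _ _ _ _ 1).
    have -> : (-2)%:~R - m%:~R * 1 = - (2 ^ C0.+1 + 3)%N%:R :> padic_int 2.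
      have Ez : -2 - m = - (2 ^ C0.+1 + 3)%N%:Z.
        by rewrite /m PoszD -[Posz (_ ^ _)]natz natrX; ring.
      by rewrite mulr1 -(rmorphB (intr : {rmorphism int -> padic_int 2})) /= Ez
                 rmorphN.
    by rewrite unitrN padic_natr_unit // prime_coprime // dvdn_addr ?dvdn_exp.
  apply: (@similar_twist _ _ _ _ 0); rewrite mulr0 subr0 rmorphN unitrN.
  by apply: padic_natr_unit => //; rewrite prime_coprime // dvdn_prime2.
rewrite /C_Q /C_K; case: pselect => [ex|[]].
  case: ex_minnP => d /asboolP.
  case/similar_in_degree_twist => [|||r /andP[r_gt0 le_rd] dvd_r _].
  - by rewrite mE addn1.
  - by rewrite mE; have := expn_gt0 2 C0; lia.
  - by rewrite mE coprimezE /= coprime2n oddD oddM.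
  rewrite leqNgt; apply/negP => ltdC0; move: dvd_r; apply/negP.
  by apply: dvdz_pow2; rewrite r_gt0 (leq_ltn_trans le_rd).
(* The exponent C0 + 1 rather than C0 makes the trinomial of degree at least 2
   even when C0 = 1. *)
have [||L [y Uy]] := @exists_unit_ext (rat^o) m 2 C0.+1; first by [].
  exact: dvdzz.
exists (\dim {:L}); apply/asboolP; exists L; split=> //.
rewrite !map_twist_incl; apply: (@similar_twist _ _ _ _ (- y)).
by rewrite mulrN opprK addrC rmorphN.
Qed.
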